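(* For all integers $n\geq 1$, $$H_1(n,n)=\frac13\left(4^{n-1}-1\right).$$
   Context: For positive integers $r,n,k$, let $H_r(n,k)$ be the number of $n\times k$ arrays of integers (rows indexed $i=1,\dots,n$, columns indexed $j=1,\dots,k$) which obey the following rules: (1) the entry in position $(1,1)$ is $0$, and the entry in position $(n,k)$ is $\max(n,k)-r-1$; (2) the entry in position $(i,j)$ must equal or be one more than each of the entries in positions $(i-1,j)$, $(i,j-1)$, and $(i-1,j-1)$ (whenever those positions exist in the array); (3) the entry in position $(i,j)$ must be within $r$ of $\max(i,j)-1$, i.e. differ from it by at most $r$ in absolute value. (If the rules are contradictory, as for $n=k=1$, the count is $0$.) *)

(* Defs.v *)
From mathcomp Require Import all_boot all_order all_algebra.
From mathcomp Require Import finmap.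
From mathcomp Require Import boolp classical_sets functions cardinality.

Set Implicit Arguments.
Unset Strict Implicit.
Unset Printing Implicit Defensive.

Import Order.TTheory GRing.Theory Num.Theory.

Local Open Scope ring_scope.
Local Open Scope classical_set_scope.

Definition eq_or_succ (a b : int) : Prop := b = a \/ b = a + 1.

(* Ordinals start at 0: the entry written (i, j) with 1-based indices is
   A (i - 1) (j - 1), so max(i, j) - 1 is the maximum of the two ordinals. *)
Record is_array (r n k : nat) (A : 'M[int]_(n, k)) : Prop := {
  array_first : forall (i : 'I_n) (j : 'I_k),
    i = 0%N :> nat -> j = 0%N :> nat -> A i j = 0;
  array_last : forall (i : 'I_n) (j : 'I_k),
    i.+1 = n -> j.+1 = k -> A i j = (maxn n k)%:Z - r%:Z - 1;
  array_above : forall (i i' : 'I_n) (j : 'I_k),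
    i' = i.+1 :> nat -> eq_or_succ (A i j) (A i' j);
  array_left : forall (i : 'I_n) (j j' : 'I_k),
    j' = j.+1 :> nat -> eq_or_succ (A i j) (A i j');
  array_diag : forall (i i' : 'I_n) (j j' : 'I_k),
    i' = i.+1 :> nat -> j' = j.+1 :> nat -> eq_or_succ (A i j) (A i' j');
  array_near : forall (i : 'I_n) (j : 'I_k),
    `|A i j - (maxn i j)%:Z| <= r%:Z }.

Arguments is_array : clear implicits.

Definition arrays (r n k : nat) : set 'M[int]_(n, k) :=
  [set A | is_array r n k A].

Arguments arrays : clear implicits.

(* fset_set is set by convention to the empty set on infinite sets; this
   shows that the convention plays no role in H. *)
Lemma finite_arrays (r n k : nat) : finite_set (arrays r n k).
Proof.
pose N := (maxn n k + r + r)%N.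
pose f (B : 'M['I_N.+1]_(n, k)) : 'M[int]_(n, k) :=
  \matrix_(i, j) ((B i j)%:Z - r%:Z).
apply: (@sub_finite_set _ _ (range f)); last exact: finite_image.
move=> A [_ _ _ _ _ near]; exists (\matrix_(i, j) inord (absz (A i j + r%:Z))) => //.
apply/matrixP => i j; rewrite !mxE.
have := near i j; rewrite ler_norml lerBrDr lerBlDr => /andP[lo hi].
have ge0 : 0 <= A i j + r%:Z.
  by rewrite -(lerD2r (- r%:Z)) addrK add0r (le_trans _ lo)// lerDl.
rewrite inordK ?gez0_abs ?addrK// ltnS -lez_nat gez0_abs//.
rewrite /N !PoszD lerD2r (le_trans hi)// addrC lerD2r lez_nat.
by rewrite geq_max !leq_max (ltnW (ltn_ord i)) (ltnW (ltn_ord j)) orbT.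
Qed.

Definition H (r n k : nat) : nat := #|` fset_set (arrays r n k)|%fset.

(* Main.v *)
Require Import Defs.
From mathcomp Require Import all_boot all_order all_algebra.
From mathcomp Require Import finmap zify ring.
From mathcomp Require Import classical_sets cardinality.

Set Implicit Arguments.
Unset Strict Implicit.
Unset Printing Implicit Defensive.

Import Order.TTheory GRing.Theory Num.Theory.

Local Open Scope ring_scope.

(** Following diagonal steps and then straight ones from the corner, an entry
is at most [max(i, j)], so for [r = 1] it is [max(i, j) - D i j] with [D i j]
a bit. On and above the diagonal, the rules say that [D] is nondecreasing
along rows and diagonals and nonincreasing down columns. Let [d + 1] be the
position, from 0, of the first 1 on the diagonal. The first 1 of row [i] is then in a
column [c i] with [c d = d + 1] and [c i] equal to [c (i + 1)] or
[c (i + 1) - 1] for [i < d], all choices being possible: this part of the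
array amounts to the set of those [i < d] where [c] jumps. The part below the
diagonal is encoded likewise with the same [d], so the number of arrays is the
sum of [2 ^ d * 2 ^ d] over [d < n - 1]. *)

(** [S] stands for the rows [k] with [c (k + 1) = c k + 1]; for [i <= d] the count is then
    [c d - c i]. *)
Definition count_from d (S : {set 'I_d}) (i : nat) : nat :=
  #|[set k in S | (i <= k)%N]|.

Lemma count_from_le d (S : {set 'I_d}) i : (count_from S i <= d - i)%N.
Proof.
rewrite /count_from; have [di|id] := leqP d i.
  have -> : (d - i = 0)%N by lia.
  rewrite leqn0 cards_eq0; apply/eqP/setP => k; rewrite !inE.
  by rewrite leqNgt (leq_trans (ltn_ord k) di) andbF.
have lt (k : 'I_d) : (k - i < (d - i).-1.+1)%N by have := ltn_ord k; lia.
rewrite -[X in (_ <= X)%N](prednK (n := d - i)) ?subn_gt0//.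
rewrite -[X in (_ <= X)%N]card_ord.
rewrite -(card_in_imset (f := fun k => Ordinal (lt k))) ?max_card//.
move=> k k'; rewrite !inE => /andP[_ ik] /andP[_ ik'] /(congr1 val)/= e.
by apply: val_inj => /=; lia.
Qed.

Lemma count_fromS d (S : {set 'I_d}) (k : 'I_d) :
  count_from S k = ((k \in S) + count_from S k.+1)%N.
Proof.
rewrite /count_from (cardsD1 k) inE leqnn andbT; congr (_ + _)%N.
apply: eq_card => l; rewrite !inE ltn_neqAle (inj_eq val_inj) (eq_sym l).
by case: (k != l) => /=; rewrite ?andbF.
Qed.

Lemma count_from_step d (S : {set 'I_d}) i :
  (count_from S i.+1 <= count_from S i <= (count_from S i.+1).+1)%N.
Proof.
have [di|id] := leqP d i.
  by have := count_from_le S i; have := count_from_le S i.+1; lia.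
by rewrite (count_fromS S (Ordinal id)) /=; case: (_ \in S); lia.
Qed.

Lemma count_from_inj d (S T : {set 'I_d}) :
  (forall i, count_from S i = count_from T i) -> S = T.
Proof.
move=> eqST; apply/setP => k; have := eqST k.
by rewrite !count_fromS eqST; do 2 case: (k \in _); lia.
Qed.

(** For [i < d], the 1s of row [i] form a final segment. Passing to row [i + 1], monotonicity down
    columns keeps its start from moving left, and monotonicity along diagonals keeps it from moving
    right by more than 1. *)
Lemma bits_encoding n d (D : nat -> nat -> bool) : (d < n)%N ->
  (forall i, (i <= n)%N -> D i i = (d < i)%N) ->
  (forall i j, (i <= j < n)%N -> D i j -> D i j.+1) ->
  (forall i j, (i < j <= n)%N -> D i.+1 j -> D i j) ->
  (forall i j, (i <= j < n)%N -> D i j -> D i.+1 j.+1) ->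
  exists S : {set 'I_d}, forall i j, (i <= j <= n)%N ->
    D i j = (d < j + count_from S i)%N.
Proof.
move=> dn diag right down slant.
have row i j j' : (i <= j)%N -> (j <= j' <= n)%N -> D i j -> D i j'.
  move=> ij /andP[/subnK <-]; elim: (j' - j)%N => // m IH le Dij.
  by rewrite addSn; apply: right; [lia | apply: IH => //; lia].
(* A jump after row [k] shows as a column beyond [k] with a 1 over a 0. *)
pose S := [set k : 'I_d |
  [exists j : 'I_n.+1, [&& (k < j)%N, D k j & ~~ D k.+1 j]]].
(* Induction from row [d] back to row 0; truncated subtraction puts all rows [i >= d] in the base
   case. *)
exists S => i j; move: {2}(d - i)%N (erefl (d - i)%N) => m.
elim: m i j => [|m IH] i j dim ijn.
  have cnt0 : count_from S i = 0%N by have := count_from_le S i; lia.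
  rewrite cnt0 addn0; have [ltdj|ledj] := ltnP d j; last first.
    have -> : i = j by lia.
    by rewrite diag; lia.
  have [->|ne] := eqVneq i d.
    (* The diagonal 1 at [d + 1] spreads right along its row, then up to row [d]. *)
    by apply: down; [lia | apply: (row _ d.+1); [lia|lia|rewrite diag; lia]].
  by apply: (row _ i); [lia|lia|rewrite diag; lia].
have id : (i < d)%N by lia.
have [eij|ne] := eqVneq i j.
  by rewrite -eij diag ?(leq_trans _ dn)//; have := count_from_le S i; lia.
have ltij : (i < j)%N by lia.
rewrite (count_fromS S (Ordinal id)) /= inE /=.
have IHi j' : (i.+1 <= j' <= n)%N -> D i.+1 j' = (d < j' + count_from S i.+1)%N.
  by apply: IH; lia.
(* At a jump, [slant] shows that row [i] starts at most one column before row [i + 1], and the 1 at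
   [j0] that it starts at least one before. *)
case: existsP => [[j0 /and3P[ij0 Dij0]]|none].
  have j0n := ltn_ord j0.
  rewrite IHi; last lia.
  move=> j0S; apply/idP/idP => [Dij|le]; last by apply: (row _ j0) => //; lia.
  have [jn|nj] := ltnP j n; last by lia.
  by have := slant i j; rewrite IHi; [move/(_ _ Dij); lia | lia].
(* Without a jump, rows [i] and [i + 1] agree to the right of column [i]. *)
rewrite add0n -IHi; last lia.
apply/idP/idP => [Dij|]; last by apply: down; lia.
apply/negPn/negP => nD; apply: none.
have jn : (j < n.+1)%N by lia.
by exists (Ordinal jn); rewrite /= ltij Dij nD.
Qed.

(* With [c i = d + 1 - count_from S i], the condition is [c i <= j], written
without subtraction. *)
Definition bit d (S T : {set 'I_d}) (i j : nat) : bool :=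
  if (i <= j)%N then (d < j + count_from S i)%N
  else (d < i + count_from T j)%N.

Lemma bit_diag d (S T : {set 'I_d}) i : bit S T i i = (d < i)%N.
Proof. by rewrite /bit leqnn; have := count_from_le S i; lia. Qed.

Lemma bitC d (S T : {set 'I_d}) i j : bit S T i j = bit T S j i.
Proof.
have [->|ne] := eqVneq i j; first by rewrite !bit_diag.
by rewrite /bit; case: (ltngtP i j) ne.
Qed.

(** If the maximum stays, a rising bit would lower the entry; if it grows by one, a falling bit
    would raise the entry by 2. *)
Lemma eq_or_succ_bit (M M' : nat) (b b' : bool) :
  (M' = M /\ (b' -> b)) \/ (M' = M.+1 /\ (b -> b')) ->
  eq_or_succ (M%:Z - b%:Z) (M'%:Z - b'%:Z).
Proof.
rewrite /eq_or_succ => -[] [->]; case: b; case: b' => H; lia.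
Qed.

Lemma bit_step_right d (S T : {set 'I_d}) i j :
  eq_or_succ ((maxn i j)%:Z - (bit S T i j)%:Z)
             ((maxn i j.+1)%:Z - (bit S T i j.+1)%:Z).
Proof.
apply: eq_or_succ_bit; have [ij|ji] := leqP i j.
  by right; rewrite /bit ij leqW//; split; lia.
left; split; first lia.
rewrite 2!(bitC S T) /bit ji (ltnW ji).
by have := count_from_step T j; lia.
Qed.

Lemma bit_step_down d (S T : {set 'I_d}) i j :
  eq_or_succ ((maxn i j)%:Z - (bit S T i j)%:Z)
             ((maxn i.+1 j)%:Z - (bit S T i.+1 j)%:Z).
Proof. by rewrite 2!(bitC S T) 2!(maxnC _ j); exact: bit_step_right. Qed.

Lemma bit_step_diag d (S T : {set 'I_d}) i j :
  eq_or_succ ((maxn i j)%:Z - (bit S T i j)%:Z)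
             ((maxn i.+1 j.+1)%:Z - (bit S T i.+1 j.+1)%:Z).
Proof.
apply: eq_or_succ_bit; right; split; first lia.
rewrite /bit ltnS; case: (leqP i j) => _.
  by have := count_from_step S i; lia.
by have := count_from_step T j; lia.
Qed.

(** The last entry [n - 1] forces a 1 at diagonal position [n], so the first one, [d + 1], has
    [d < n]. *)
Definition code n := {d : 'I_n & {set 'I_d} * {set 'I_d}}%type.

Definition decode n (x : code n) : 'M[int]_n.+1 :=
  \matrix_(i, j)
    ((maxn i j)%:Z - (bit (tagged x).1 (tagged x).2 i j)%:Z).

Lemma decode_is_array n (x : code n) : is_array 1 n.+1 n.+1 (decode x).
Proof.
case: x => d [S T]; have dn := ltn_ord d.
split=> [i j i0 j0|i j [ei] [ej]|i i' j e|i j j' e|i i' j j' e e'|i j];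
  rewrite !mxE /=.
- by rewrite i0 j0 bit_diag.
- by rewrite ei ej bit_diag dn; lia.
- by rewrite e; exact: bit_step_down.
- by rewrite e; exact: bit_step_right.
- by rewrite e e'; exact: bit_step_diag.
- by case: (bit _ _ _ _); lia.
Qed.

Lemma decodeE n (x : code n) i j : (i <= n)%N -> (j <= n)%N ->
  decode x (inord i) (inord j) =
  (maxn i j)%:Z - (bit (tagged x).1 (tagged x).2 i j)%:Z.
Proof. by move=> ? ?; rewrite mxE !inordK. Qed.

Lemma count_from_eq n d (S T : {set 'I_d}) : (d < n)%N ->
  (forall i j, (i <= j <= n)%N ->
     (d < j + count_from S i)%N = (d < j + count_from T i)%N) ->
  S = T.
Proof.
move=> dn eqST; apply: count_from_inj => i.
have := count_from_le S i; have := count_from_le T i.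
have [di|id] := leqP d i; first lia.
(* These are the columns of the first 1 of row [i] for [S] and for [T]; each has to carry a 1 for
   the other set too, so they coincide. *)
have := eqST i (d.+1 - count_from S i)%N; have := eqST i (d.+1 - count_from T i)%N.
lia.
Qed.

Lemma decode_inj n : injective (@decode n).
Proof.
move=> [d [S T]] [d' [S' T']] eqM.
have eqB i j : (i <= n)%N -> (j <= n)%N -> bit S T i j = bit S' T' i j.
  move=> li lj; have := congr1 (fun M : 'M_n.+1 => M (inord i) (inord j)) eqM.
  by rewrite !decodeE//=; do 2 case: (bit _ _ _ _); lia.
have dd' : d = d'.
  apply: val_inj => /=; have dn := ltn_ord d; have d'n := ltn_ord d'.
  (* The 1 at [d + 1] gives [d' <= d], and symmetrically. *)
  by have := eqB d.+1 d.+1; have := eqB d'.+1 d'.+1; rewrite !bit_diag; lia.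
subst d'; have dn := ltn_ord d.
have -> : S = S'.
  apply: (count_from_eq dn) => i j /andP[ij jn].
  by have := eqB i j (leq_trans ij jn) jn; rewrite /bit ij.
have -> // : T = T'.
apply: (count_from_eq dn) => i j /andP[ij jn].
by have := eqB j i jn (leq_trans ij jn); rewrite 2!(bitC _ _ j) /bit ij.
Qed.

Lemma decode_surj n (A : 'M[int]_n.+1) :
  is_array 1 n.+1 n.+1 A -> exists x : code n, decode x = A.
Proof.
case=> first last above left slant near.
(* Indices beyond [n] fall back to 0 under [inord], hence the bounds in the facts below. *)
pose a (i j : nat) : int := A (inord i) (inord j).
have a00 : a 0 0 = 0 by apply: first; rewrite inordK.
have ann : a n n = n%:Z - 1 by rewrite /a last ?inordK//; lia.
have ab i j : (i < n)%N -> (j <= n)%N -> eq_or_succ (a i j) (a i.+1 j).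
  by move=> *; apply: above; rewrite !inordK// ltnW.
have le i j : (i <= n)%N -> (j < n)%N -> eq_or_succ (a i j) (a i j.+1).
  by move=> *; apply: left; rewrite !inordK// ltnW.
have sl i j : (i < n)%N -> (j < n)%N -> eq_or_succ (a i j) (a i.+1 j.+1).
  by move=> *; apply: slant; rewrite !inordK// ltnW.
have nr i j : (i <= n)%N -> (j <= n)%N -> `|a i j - (maxn i j)%:Z| <= 1.
  by move=> li lj; have := near (inord i) (inord j); rewrite !inordK.
have up i j : (i <= n)%N -> (j <= n)%N -> a i j <= (maxn i j)%:Z.
  elim: i j => [|i IHi] [|j] li lj; first by rewrite a00.
  - elim: j lj => [|j IHj] lj.
      by have := le 0%N 0%N isT lj; rewrite /eq_or_succ a00; lia.
    by have := le 0%N j.+1 isT lj; have := IHj (ltnW lj); rewrite /eq_or_succ; lia.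
  - by have := ab i 0%N li isT; have := IHi 0%N (ltnW li) isT;
      rewrite /eq_or_succ; lia.
  - by have := sl i j li lj; have := IHi j (ltnW li) (ltnW lj);
      rewrite /eq_or_succ; lia.
pose D i j := a i j != (maxn i j)%:Z.
have aE i j : (i <= n)%N -> (j <= n)%N -> a i j = (maxn i j)%:Z - (D i j)%:Z.
  move=> li lj; have := nr i j li lj; have := up i j li lj.
  by rewrite /D; case: eqVneq => /=; lia.
have Dsl i j : (i < n)%N -> (j < n)%N -> D i j -> D i.+1 j.+1.
  move=> li lj; have := sl i j li lj; rewrite !aE// ?(ltnW li) ?(ltnW lj)//.
  by rewrite /eq_or_succ; do 2 case: (D _ _) => //=; lia.
have Dright i j : (i <= j)%N -> (j < n)%N -> D i j -> D i j.+1.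
  move=> ij jn; have := le i j (leq_trans ij (ltnW jn)) jn.
  by rewrite !aE; try lia; rewrite /eq_or_succ; do 2 case: (D _ _) => //=; lia.
have Ddown i j : (i < j)%N -> (j <= n)%N -> D i.+1 j -> D i j.
  move=> ij jn; have := ab i j (leq_trans ij jn) jn.
  by rewrite !aE; try lia; rewrite /eq_or_succ; do 2 case: (D _ _) => //=; lia.
have Dbelow j i : (j <= i)%N -> (i < n)%N -> D i j -> D i.+1 j.
  move=> ji li; have := ab i j li (leq_trans ji (ltnW li)).
  by rewrite !aE; try lia; rewrite /eq_or_succ; do 2 case: (D _ _) => //=; lia.
have Dleft j i : (j < i)%N -> (i <= n)%N -> D i j.+1 -> D i j.
  move=> ji li; have := le i j li (leq_trans ji li).
  by rewrite !aE; try lia; rewrite /eq_or_succ; do 2 case: (D _ _) => //=; lia.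
have Dnn : D n n by rewrite /D ann; lia.
have D00 : ~~ D 0%N 0%N by rewrite /D a00.
have exD : exists i, D i i by exists n.
case: (ex_minnP exD) => -[|d] Dd dmin; first by rewrite Dd in D00.
have dn : (d < n)%N := dmin n Dnn.
have diag i : (i <= n)%N -> D i i = (d < i)%N.
  move=> li; apply/idP/idP => [/dmin//|di].
  rewrite -(subnK di) in li *; elim: (i - d.+1)%N li => // m IH li.
  by apply: Dsl => //; apply: IH; apply: ltnW.
have [i j|i j|i j|S DS] := @bits_encoding n d D dn diag.
- by move=> /andP[ij jn]; apply: Dright.
- by move=> /andP[ij jn]; apply: Ddown.
- by move=> /andP[ij jn]; apply: Dsl => //; lia.
(* Transposing turns the lower triangle into an upper one with the same diagonal, hence the same
   [d]. *)
have [i j|i j|i j|T DT] := @bits_encoding n d (fun i j => D j i) dn diag.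
- by move=> /andP[ij jn]; apply: Dbelow.
- by move=> /andP[ij jn]; apply: Dleft.
- by move=> /andP[ij jn]; apply: Dsl => //; lia.
exists (existT _ (Ordinal dn) (S, T)); apply/matrixP => i j; rewrite mxE /=.
have in' := ltn_ord i; have jn := ltn_ord j.
rewrite -[in RHS](inord_val i) -[in RHS](inord_val j) -/(a i j) aE -1?ltnS//.
by rewrite /bit; case: (leqP i j) => ij; rewrite -?DS -?DT//; lia.
Qed.

Lemma card_code n : #|{: code n}| = (\sum_(d < n) 4 ^ d)%N.
Proof.
rewrite card_tagged sumnE big_map big_enum /=; apply: eq_bigr => d _.
by rewrite card_prod -cardsT -powersetT card_powerset cardsT card_ord -expnMn.
Qed.

Lemma H1E n : H 1 n.+1 n.+1 = (\sum_(d < n) 4 ^ d)%N.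
Proof.
rewrite -card_code /H.
have -> : arrays 1 n.+1 n.+1 = [set` [fset decode x | x in {: code n}]%fset]%classic.
  apply/seteqP; split=> A /=.
    by move/decode_surj => [x <-]; apply/imfsetP; exists x.
  by case/imfsetP => x _ ->; exact: decode_is_array.
rewrite set_fsetK card_imfset; last exact: decode_inj.
by rewrite cardE.
Qed.

Theorem theorem1 (n : nat) (hn : (1 <= n)%N) :
  (H 1 n n)%:R = 3^-1 * (4 ^+ n.-1 - 1) :> rat.
Proof.
case: n hn => // n _; rewrite H1E /=.
elim: n => [|n IH]; first by rewrite big_ord0 subrr mulr0.
by rewrite big_ord_recr /= natrD IH natrX exprS; field.
Qed.
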